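(* Let $\Gamma$ be a connected weak metacirculant whose order $|V(\Gamma)|$ is a power $2^k$ of $2$ with $k\geq 1$. Then $\Gamma$ is a metacirculant if and only if $\Gamma$ is a split weak metacirculant.
   Context: All graphs are finite, simple and undirected. The order of a graph $\Gamma$ is $|V(\Gamma)|$, and an automorphism group of $\Gamma$ means a subgroup of $\mathrm{Aut}(\Gamma)$. A group $G$ is metacyclic if it has a cyclic normal subgroup $N$ with $G/N$ cyclic. It is split metacyclic if it is a semidirect product $C_n:C_m$ of a normal cyclic subgroup $C_n$ by a cyclic group $C_m$ (i.e. there is a cyclic normal subgroup having a cyclic complement). For integers $m\geq 1$, $n\geq 2$, a graph $\Gamma$ of order $mn$ is an $(m,n)$-metacirculant if it has two automorphisms $\sigma,\tau$ such that: (1) $\langle\sigma\rangle$ is semiregular (all vertex stabilizers in $\langle\sigma\rangle$ are trivial) and has $m$ orbits on $V(\Gamma)$; (2) $\tau$ normalizes $\langle\sigma\rangle$ and cyclically permutes the $m$ orbits of $\langle\sigma\rangle$; (3) $\tau$ has a cycle of size $m$ in its cycle decomposition on $V(\Gamma)$. A metacirculant is a graph that is an $(m,n)$-metacirculant for some $m$ and $n$. A weak metacirculant is a graph that has a vertex-transitive metacyclic automorphism group. A split weak metacirculant is a weak metacirculant that has a vertex-transitive split metacyclic automorphism group. *)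

(* Defs.v *)
From mathcomp Require Import all_boot all_fingroup all_solvable.

Set Implicit Arguments.
Unset Strict Implicit.
Unset Printing Implicit Defensive.

Local Open Scope group_scope.

(* A simple graph on the vertex set T is a symmetric irreflexive relation     *)
(* e : rel T (adjacency); these two properties are hypotheses of the theorem. *)

Section GraphAutomorphisms.

Variables (T : finType) (e : rel T).

Definition graph_aut : {set {perm T}} :=
  [set s : {perm T} | [forall x, forall y, e (s x) (s y) == e x y]].

Lemma graph_autP (s : {perm T}) :
  reflect (forall x y, e (s x) (s y) = e x y) (s \in graph_aut).
Proof.
rewrite inE; apply: (iffP forallP) => [h x y | h x].
  by have /forallP/(_ y)/eqP := h x.
by apply/forallP=> y; rewrite h.
Qed.

Lemma graph_aut_group_set : group_set graph_aut.
Proof.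
apply/group_setP; split=> [|s t /graph_autP hs /graph_autP ht].
  by apply/graph_autP => x y; rewrite !perm1.
by apply/graph_autP => x y; rewrite !permM ht hs.
Qed.

Canonical graph_aut_group := Group graph_aut_group_set.

Definition connected_graph : Prop := forall x y : T, connect e x y.

End GraphAutomorphisms.

Definition split_metacyclic (gT : finGroupType) (A : {set gT}) : bool :=
  [exists N : {group gT}, exists K : {group gT},
    [&& cyclic N, cyclic K & N ><| K == A]].

(* Not to be confused with frobenius.semiregular, which is about the          *)
(* conjugation action inside a group.                                         *)
Definition semiregular_perms (T : finType) (A : {set {perm T}}) : Prop :=
  forall x : T, 'C_A[x | 'P] = 1.

(* t maps Os`_i onto Os`_(i + 1), indices being read modulo size Os.          *)
Definition cyclically_permutes (T : finType) (t : {perm T})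
    (P : {set {set T}}) : Prop :=
  exists2 Os : seq {set T}, Os =i P & ufcycle (fun B : {set T} => t @: B) Os.

Definition mn_metacirculant (T : finType) (e : rel T) (m n : nat) : Prop :=
  [/\ (1 <= m)%N, (2 <= n)%N, #|T| = (m * n)%N &
    exists s t : {perm T},
      [/\ s \in graph_aut e /\ t \in graph_aut e,
          semiregular_perms <[s]> /\ #|porbits s| = m,
          t \in 'N(<[s]>) /\ cyclically_permutes t (porbits s)
        & exists2 C : {set T}, C \in porbits t & #|C| = m]].

Definition metacirculant (T : finType) (e : rel T) : Prop :=
  exists m n : nat, mn_metacirculant e m n.

Definition weak_metacirculant (T : finType) (e : rel T) : Prop :=
  exists G : {group {perm T}},
    [/\ G \subset graph_aut e, [transitive G, on [set: T] | 'P]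
      & metacyclic G].

Definition split_weak_metacirculant (T : finType) (e : rel T) : Prop :=
  weak_metacirculant e /\
  exists G : {group {perm T}},
    [/\ G \subset graph_aut e, [transitive G, on [set: T] | 'P]
      & split_metacyclic G].

(* Main.v *)
Require Import Defs.
From mathcomp Require Import all_boot all_fingroup all_solvable.

(* If (s, t) witnesses a metacirculant, every power of t in <s> fixes the
   vertices of the t-cycle of length m, so <s> meets <t> trivially and the
   transitive group <s><t> is the split extension <s> ><| <t>.
   Conversely, let <a> ><| <b> be transitive, where b may be assumed to be a
   2-element. Then <a> is semiregular, with m orbits say, and b cyclically
   permutes these orbits; it remains to find a vertex fixed by c = b ^+ m.
   The stabilizer of a vertex v contains some c * x with x in <a>. If m > 1 then
   c is a square, so it acts on <a> by an exponent R = 1 mod 4, and faithfully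
   since the stabilizer is core-free. It follows that c * x is conjugate to c,
   which thus has a fixed vertex. If m = 1, the pair (a, 1) works, and if
   a = 1, the pair (b, 1). *)

Section Helpers.
Set Implicit Arguments.
Unset Strict Implicit.
Unset Printing Implicit Defensive.

Local Open Scope group_scope.

(** * Geometric sums and conjugation by exponents *)

(** Doubling the number of terms multiplies the sum by [1 + R ^ 2 ^ t], which is 2 modulo 4. *)
Lemma geometric_sum_pow2 (R t : nat) : R = 1 %[mod 4] ->
  exists2 q, odd q & (\sum_(i < 2 ^ t) R ^ i = 2 ^ t * q)%N.
Proof.
move=> R1; elim: t => [|t [q q_odd IH]].
  by exists 1%N; rewrite // big_ord1.
have Rt1 : (R ^ 2 ^ t %% 4 = 1)%N by rewrite -modnXm R1 modnXm exp1n.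
have /dvdnP[w Ew]: (4 %| R ^ 2 ^ t - 1)%N.
  by rewrite -eqn_mod_dvd ?Rt1 // lt0n; apply/eqP=> R0; rewrite R0 in Rt1.
have Ew1: (1 + R ^ 2 ^ t = 2 * (w.*2.+1))%N.
  rewrite -(subnK (_ : 1 <= R ^ 2 ^ t)%N) ?Ew.
    by rewrite addnCA addnC [in RHS]mulnS -muln2 [in RHS]mulnCA.
  by rewrite lt0n; apply/eqP=> R0; rewrite R0 in Rt1.
exists (q * w.*2.+1)%N; first by rewrite oddM q_odd /= odd_double.
have -> : (\sum_(i < 2 ^ t.+1) R ^ i
           = (\sum_(i < 2 ^ t) R ^ i) * (1 + R ^ 2 ^ t))%N.
  rewrite expnS mul2n -addnn big_split_ord /= mulnDr muln1; congr addn.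
  by rewrite big_distrl /=; apply: eq_bigr => i _; rewrite expnD mulnC.
by rewrite IH Ew1 expnS -!mulnA [(q * _)%N]mulnCA mulnCA.
Qed.

Lemma conj_expg_iter (gT : finGroupType) (c x : gT) (R j : nat) :
  x ^ c = x ^+ R -> x ^ (c ^+ j) = x ^+ (R ^ j)%N.
Proof.
move=> xc; elim: j => [|j IH]; first by rewrite expg0 conjg1.
by rewrite expgSr conjgM IH conjXg xc -expgM -expnS.
Qed.

(** Collecting the factors [c] on the left conjugates the copies of [x] by successive powers of
    [c]. *)
Lemma expMg_twisted (gT : finGroupType) (c x : gT) (R j : nat) :
  x ^ c = x ^+ R -> (c * x) ^+ j = c ^+ j * x ^+ (\sum_(i < j) R ^ i)%N.
Proof.
move=> xc; elim: j => [|j IH]; first by rewrite big_ord0 !expg0 mulg1.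
rewrite expgS IH big_ord_recr /= addnC expgD -(conj_expg_iter _ xc).
rewrite expgS !mulgA; congr (_ * _).
by rewrite -!mulgA -conjgC.
Qed.

Lemma expn_pow2_geometric (R t : nat) : R = 1 %[mod 4] ->
  exists q, (R ^ 2 ^ t = 1 + (R - 1) * 2 ^ t * q)%N.
Proof.
move=> R1; have [q _ Eq] := geometric_sum_pow2 t R1; exists q.
have R_gt0 : (0 < R)%N by case: R R1 {Eq}.
by rewrite -mulnA -Eq subn1 -predn_exp add1n prednK // expn_gt0 R_gt0.
Qed.

(* H^1(<c>, <a>) = 0: the norm map x |-> x ^+ (1 + R + ...) kills exactly the
   elements of order dividing 2 ^ t, and by faithfulness of the action these
   all are powers of a ^+ (R - 1), i.e., commutators [~ c, y]. *)
Lemma conj_of_faithful_action (gT : finGroupType) (a c x : gT) (R t : nat) :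
    2.-elt a -> R = 1 %[mod 4] -> a ^ c = a ^+ R -> x \in <[a]> ->
    c ^+ (2 ^ t) = 1 -> (c * x) ^+ (2 ^ t) = 1 ->
    (forall s, t = s.+1 -> a ^ (c ^+ (2 ^ s)) != a) ->
  exists y, c * x = c ^ y.
Proof.
move=> pa R1 ac xa ct cxt faith.
have R_gt0 : (0 < R)%N by case: R R1 {ac}.
have xc : x ^ c = x ^+ R.
  by case/cycleP: xa => i ->; rewrite conjXg ac -!expgM mulnC.
have x_dvd : #[x] %| 2 ^ t.
  have [q q_odd Eq] := geometric_sum_pow2 t R1.
  move/eqP: cxt; rewrite (expMg_twisted _ xc) ct mul1g Eq -order_dvdn.
  rewrite Gauss_dvdl //.
  apply: (@pnat_coprime 2); first exact: mem_p_elt xa.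
  by rewrite p'natE // dvdn2 q_odd.
set y0 := a ^+ (R - 1).
have y0a : y0 \in <[a]> by rewrite mem_cycle.
have y0_dvd : 2 ^ t %| #[y0].
  have /p_natP[u Eu] : 2.-nat #[y0] by apply: mem_p_elt y0a.
  rewrite Eu dvdn_Pexp2l // leqNgt; apply/negP=> lt_ut.
  (* If [y0] had order less than [2 ^ t], its [2 ^ s]-th power would be trivial, and [c ^+ (2 ^ s)]
     would centralize [a]. *)
  case: t faith lt_ut {ct cxt x_dvd} => // s /(_ s erefl)/negP faith.
  rewrite ltnS => le_us; apply: faith; rewrite (conj_expg_iter _ ac).
  have [q ->] := expn_pow2_geometric s R1.
  rewrite expgD expg1 !expgM -/y0.
  have /eqP-> : y0 ^+ (2 ^ s) == 1 by rewrite -order_dvdn Eu dvdn_exp2l.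
  by rewrite expg1n mulg1.
have : x \in <[y0]>.
  rewrite -cycle_subG -(cardSg_cyclic (cycle_cyclic a)) ?cycle_subG //.
  exact: dvdn_trans x_dvd y0_dvd.
(* Conjugating [c] by [a ^- j] multiplies it on the right by [a ^+ (R * j) * a ^- j], which is
   [y0 ^+ j]. *)
case/cycleP=> j ->; exists (a ^- j).
rewrite conjgE invgK mulgA (conjgC (a ^+ j)) conjXg ac -mulgA; congr (_ * _).
apply: (mulIg (a ^+ j)); rewrite mulgKV -!expgM -expgD.
by rewrite -{2}[j]mul1n -mulnDl subnK.
Qed.

(** * Semiregular cyclic groups and their orbits *)

(** Any point is [g x] with [g] in [G]; as [z ^ g^-1] is a power of [z], it fixes [x], so [z] fixes
    [g x]. *)
Lemma normal_fix_eq1 (T : finType) (G : {group {perm T}}) (z : {perm T}) x :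
    [transitive G, on [set: T] | 'P] -> G \subset 'N(<[z]>) ->
  z x = x -> z = 1.
Proof.
move=> trG nzG zx; apply/permP=> y; rewrite perm1.
have [g Gg ->] := atransP2 trG (in_setT x) (in_setT y).
have: z ^ g^-1 \in <[z]>.
  by rewrite memJ_norm ?cycle_id // groupV (subsetP nzG).
case/cycleP=> i /(canRL (conjgKV g)) Ez.
rewrite /= apermE Ez conjgE !permM permK; congr (g _).
by rewrite permX iter_fix.
Qed.

Lemma semiregularP (T : finType) (s : {perm T}) :
  semiregular_perms <[s]> <->
    (forall z x, z \in <[s]> -> z x = x -> z = 1).
Proof.
split=> [sr z x sz zx | sr x].
  have: z \in 'C_<[s]>[x | 'P] by rewrite inE sz; apply/astab1P.
  by rewrite sr => /set1P.
apply/trivgP/subsetP=> z /setIP[sz /astab1P zx].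
by apply/set1P/(sr z x).
Qed.

Lemma imset_porbit (T : finType) (s t : {perm T}) x :
  t \in 'N(<[s]>) -> t @: porbit s x = porbit s (t x).
Proof.
move=> nst; rewrite !porbitE; apply/setP=> y; apply/imsetP/orbitP.
  case=> _ /orbitP[z sz <-] ->; exists (z ^ t); first by rewrite memJ_norm.
  by rewrite /= !apermE conjgE !permM permK.
case=> z sz <-; exists ((z ^ t^-1) x).
  by apply/orbitP; exists (z ^ t^-1); rewrite // memJ_norm // groupV.
by rewrite /= !apermE -!permM conjgE invgK !mulgA mulgKV.
Qed.

Lemma iter_imset_porbit (T : finType) (s t : {perm T}) x i :
  t \in 'N(<[s]>) ->
  iter i (fun B : {set T} => t @: B) (porbit s x) = porbit s ((t ^+ i) x).
Proof.
move=> nst; elim: i => [|i IH]; first by rewrite expg0 perm1.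
by rewrite iterS IH imset_porbit // expgSr permM.
Qed.

Lemma card_semiregular (T : finType) (s : {perm T}) :
  semiregular_perms <[s]> -> #|T| = (#|porbits s| * #[s])%N.
Proof.
move=> sr; rewrite -cardsT.
have part: partition (porbits s) [set: T].
  have -> : porbits s = orbit 'P <[s]> @: [set: T].
    by apply/setP=> B; apply/imsetP/imsetP => -[x _ ->]; exists x;
      rewrite ?porbitE.
  apply: orbit_partition; apply/actsP=> z _ x; by rewrite !inE.
apply: card_uniform_partition part => B /imsetP[x _ ->].
by rewrite porbitE card_orbit sr indexg1.
Qed.

Section Pair.
Variables (T : finType) (s t : {perm T}).
Hypothesis nst : t \in 'N(<[s]>).

Let f (B : {set T}) := t @: B.

Let f_inj : injective f.
Proof. exact/imset_inj/perm_inj. Qed.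

Lemma joing_cycle_normal : <[s]> <*> <[t]> = <[s]> * <[t]>.
Proof. by rewrite norm_joinEr // cycle_subG. Qed.

(** The group consists of the products [s ^+ i * t ^+ j], and [s ^+ i] preserves each orbit of [s],
    so powers of [t] alone reach all orbits. *)
Lemma fconnect_porbits x :
  [transitive <[s]> <*> <[t]>, on [set: T] | 'P] ->
  fconnect f (porbit s x) =i porbits s.
Proof.
move=> tr B; apply/idP/imsetP=> [/iter_findex <- | [y _ ->]].
  by rewrite iter_imset_porbit //; exists ((t ^+ findex f (porbit s x) B) x).
have [g] := atransP2 tr (in_setT x) (in_setT y).
rewrite /= joing_cycle_normal => /mulsgP[_ _ /cycleP[i ->] /cycleP[j ->] ->] ->.
rewrite /= apermE permM -iter_imset_porbit // porbit_perm.
exact: fconnect_iter.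
Qed.

Lemma transitive_cyclically_permutes :
    [transitive <[s]> <*> <[t]>, on [set: T] | 'P] ->
  cyclically_permutes t (porbits s).
Proof.
move=> tr; have /imsetP[x _ _] := tr.
exists (fingraph.orbit f (porbit s x)).
  by move=> B; rewrite -fconnect_orbit; apply: fconnect_porbits.
by rewrite /ucycle cycle_orbit // orbit_uniq.
Qed.

Lemma transitive_stab_porbit x :
    [transitive <[s]> <*> <[t]>, on [set: T] | 'P] ->
  (t ^+ #|porbits s|) x \in porbit s x.
Proof.
move=> tr; rewrite -eq_porbit_mem -iter_imset_porbit //.
by rewrite -(eq_card (fconnect_porbits x tr)) iter_order.
Qed.

Lemma cyclically_permutes_porbit x y : cyclically_permutes t (porbits s) ->
  exists i, porbit s y = porbit s ((t ^+ i) x).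
Proof.
case=> Os defOs /andP[cyc _].
have in_Os z : porbit s z \in Os by rewrite defOs imset_f.
have /iter_findex <- : fconnect f (porbit s x) (porbit s y).
  by rewrite (fconnect_cycle cyc).
by eexists; rewrite iter_imset_porbit.
Qed.

Lemma cyclically_permutes_transitive (x0 : T) :
    cyclically_permutes t (porbits s) ->
  [transitive <[s]> <*> <[t]>, on [set: T] | 'P].
Proof.
move=> cyc; apply/imsetP; exists x0; rewrite ?inE //; apply/setP=> y.
have [i] := cyclically_permutes_porbit x0 y cyc.
move/eqP; rewrite eq_porbit_mem => /porbitP[j ->].
rewrite inE; apply/esym/orbitP; exists (t ^+ i * s ^+ j).
  by rewrite groupM // groupX // mem_gen // inE cycle_id ?orbT.
by rewrite /= apermE permM.
Qed.

Lemma imset_porbits x : cyclically_permutes t (porbits s) ->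
  porbit s @: porbit t x = porbits s.
Proof.
move=> cyc; apply/setP=> B; apply/imsetP/imsetP=> -[y _ ->]; first by exists y.
have [i ->] := cyclically_permutes_porbit x y cyc.
by exists ((t ^+ i) x); rewrite ?mem_porbit.
Qed.

(** By counting, the cycle [C] meets each orbit of [s] exactly once. An element of both groups keeps
    a point of [C] in [C] and in its orbit under [s], hence fixes it. *)
Lemma cyclically_permutes_TI C :
    semiregular_perms <[s]> -> cyclically_permutes t (porbits s) ->
    C \in porbits t -> #|C| = #|porbits s| ->
  <[s]> :&: <[t]> = 1.
Proof.
move=> /semiregularP sr cyc /imsetP[x _ ->] cardC.
have inj : {in porbit t x &, injective (porbit s)}.
  by apply/imset_injP; rewrite imset_porbits // cardC.
apply/trivgP/subsetP=> z /setIP[/cycleP[i Ei] /cycleP[j Ej]].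
apply/set1P/(sr z x); first by rewrite Ei mem_cycle.
apply: inj; rewrite ?porbit_id //; first by rewrite Ej mem_porbit.
by rewrite Ei porbit_perm.
Qed.

End Pair.

(** * The two implications *)

Lemma metacirculant_split (T : finType) (e : rel T) : metacirculant e ->
  exists G : {group {perm T}},
    [/\ G \subset graph_aut e, [transitive G, on [set: T] | 'P]
      & split_metacyclic G].
Proof.
case=> m [n [_ _ _ [s [t [[As At] [sr cards] [nst cyc] [C Ct cardC]]]]]].
have /imsetP[x0 _ _] := Ct.
exists (<[s]> <*> <[t]>)%G; split.
- by rewrite join_subG !cycle_subG As.
- exact: cyclically_permutes_transitive.
apply/existsP; exists <[s]>%G; apply/existsP; exists <[t]>%G.
have ti := cyclically_permutes_TI nst sr cyc Ct (etrans cardC (esym cards)).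
by rewrite !cycle_cyclic /= sdprodEY ?cycle_subG.
Qed.

Lemma metacirculant_of_fixed (T : finType) (e : rel T) (s t : {perm T}) x :
    s \in graph_aut e -> t \in graph_aut e -> t \in 'N(<[s]>) ->
    [transitive <[s]> <*> <[t]>, on [set: T] | 'P] ->
    semiregular_perms <[s]> -> s != 1 ->
    (t ^+ #|porbits s|) x = x ->
  metacirculant e.
Proof.
move=> As At nst tr sr s1 tx.
have cyc := transitive_cyclically_permutes nst tr.
have m_gt0 : (0 < #|porbits s|)%N.
  by rewrite card_gt0; apply/set0Pn; exists (porbit s x); rewrite imset_f.
exists #|porbits s|, #[s]; split=> //.
- by rewrite ltnNge leq_eqVlt order_eq1 (negPf s1) ltnNge order_gt0.
- exact: card_semiregular.
exists s, t; split=> //; exists (porbit t x); first exact: imset_f.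
(* The cycle meets every orbit of [s], which bounds its length below; exponents of [t] at [x] reduce
   modulo the number of orbits, which bounds it above. *)
apply/eqP; rewrite eqn_leq; apply/andP; split; last first.
  by rewrite -{1}(imset_porbits nst x cyc) leq_imset_card.
have sub : porbit t x \subset
    [set (t ^+ i) x | i : 'I_#|porbits s| in predT].
  apply/subsetP=> _ /porbitP[i ->]; apply/imsetP.
  exists (Ordinal (ltn_pmod i m_gt0)) => //=.
  rewrite {1}(divn_eq i #|porbits s|) mulnC expgD expgM permM; congr (_ _).
  by rewrite permX iter_fix.
apply: leq_trans (subset_leq_card sub) _.
by rewrite -[leqRHS]card_ord leq_imset_card.
Qed.

(** The degree [p ^ k] divides [#|G : P|] times the length of a [P]-orbit, and is coprime to the
    first factor. *)
Lemma transitive_p'index (T : finType) (G P : {group {perm T}}) (p k : nat) :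
    prime p -> #|T| = (p ^ k)%N -> [transitive G, on [set: T] | 'P] ->
    P \subset G -> ~~ (p %| #|G : P|) -> [transitive P, on [set: T] | 'P].
Proof.
move=> p_pr cardT tr sPG p'GP; have /imsetP[x _ orbG] := tr.
apply/imsetP; exists x; rewrite ?inE //; apply/esym/eqP.
rewrite eqEcard subsetT cardsT cardT.
apply: dvdn_leq; first by rewrite card_orbit indexg_gt0.
have: p ^ k %| #|G : P| * #|orbit 'P P x|.
  rewrite -cardT -cardsT orbG !card_orbit.
  have sPx : 'C_P[x | 'P] \subset 'C_G[x | 'P] by rewrite setSI.
  rewrite Lagrange_index ?subsetIl //.
  rewrite -(Lagrange_index (subsetIl G 'C[x | 'P]) sPx).
  exact: dvdn_mulr.
by rewrite Gauss_dvdr // coprimeXl // prime_coprime.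
Qed.

Lemma semiregular_normal_cycle (T : finType) (G : {group {perm T}}) s :
    [transitive G, on [set: T] | 'P] -> G \subset 'N(<[s]>) ->
  semiregular_perms <[s]>.
Proof.
move=> tr nsG; apply/semiregularP=> z x sz; apply: normal_fix_eq1 tr _.
apply: char_norm_trans nsG.
by rewrite sub_cyclic_char ?cycle_cyclic ?cycle_subG.
Qed.

Lemma odd_sqr_mod4 u : odd u -> (u * u = 1 %[mod 4])%N.
Proof.
move=> u_odd; apply/eqP.
rewrite eqn_mod_dvd ?muln_gt0 ?odd_gt0 //.
rewrite -(exp1n 2) mulnn subn_sqr (@dvdn_mul 2 2) // dvdn2.
  by rewrite oddB ?odd_gt0 // u_odd.
by rewrite oddD u_odd.
Qed.

(* The involution of <[c]>, were it to centralize a, would differ from an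
   element of the point stabilizer by a central z, so the latter element would
   be central and fix every point. *)
Lemma faithful_of_fixed (T : finType) (a b c x : {perm T}) (R t : nat) (v : T) :
    b \in 'N(<[a]>) -> <[a]> :&: <[b]> = 1 ->
    [transitive <[a]> <*> <[b]>, on [set: T] | 'P] ->
    c \in <[b]> -> #[c] = (2 ^ t.+1)%N ->
    x \in <[a]> -> x ^ c = x ^+ R ->
    (c * x) v = v -> (c * x) ^+ (2 ^ t.+1) = 1 ->
  a ^ (c ^+ (2 ^ t)) != a.
Proof.
move=> nab ti tr cb oc xa xc cxv cx1; apply/eqP=> acj.
set c' := c ^+ (2 ^ t) in acj *.
set z := x ^+ (\sum_(i < 2 ^ t) R ^ i)%N.
have Eh : (c * x) ^+ (2 ^ t) = c' * z by apply: expMg_twisted.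
have za : z \in <[a]> by rewrite groupX.
have c'b : c' \in <[b]> by rewrite groupX.
have cac : commute c' a by apply/commute_sym/commgP/conjg_fixP.
have c'z : commute c' z.
  by case/cycleP: za => i ->; apply: commuteX.
have z2 : z ^+ 2 = 1.
  have : (c' * z) ^+ 2 = 1 by rewrite -Eh -expgM -expnSr.
  by rewrite expgMn // -expgM -expnSr -oc expg_order mul1g.
have zb : commute z b.
  have [-> | z1] := eqVneq z 1; first exact/commute_sym/commute1.
  apply/commgP/conjg_fixP.
  (* [<[z]>] is characteristic in [<[a]>], so [b] normalizes it and must fix its only involution. *)
  have oz : #[z] = 2 by apply: nt_prime_order.
  have nzb : b \in 'N(<[z]>).
    rewrite -cycle_subG; apply: char_norm_trans (_ : <[z]> \char <[a]>) _.
      by rewrite sub_cyclic_char ?cycle_cyclic ?cycle_subG.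
    by rewrite cycle_subG.
  have : z ^ b \in <[z]> by rewrite memJ_norm ?cycle_id.
  rewrite cycle2g // => /set2P[/eqP|//].
  by rewrite conjg_eq1 (negPf z1).
have h1 : c' * z = 1.
  apply: (@normal_fix_eq1 _ (<[a]> <*> <[b]>) _ v tr).
    apply: subset_trans (cent_sub _).
    rewrite cent_cycle join_subG !cycle_subG.
    have com g : commute g c' -> commute g z -> g \in 'C[c' * z].
      by move=> gc gz; apply/cent1P; apply: commuteM.
    apply/andP; split; apply: com.
    - exact: commute_sym.
    - by case/cycleP: za => i ->; apply: commuteX.
    - by case/cycleP: c'b => i ->; apply: commuteX.
    exact: commute_sym.
  rewrite -Eh.
  by rewrite permX iter_fix.
have : c' \in <[a]> :&: <[b]>.
  by rewrite inE c'b andbT -(groupMr _ za) h1 group1.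
by rewrite ti => /set1P/eqP; rewrite -order_dvdn oc dvdn_Pexp2l // ltnn.
Qed.

Lemma split_metacirculant (T : finType) (e : rel T) (k : nat)
    (G : {group {perm T}}) :
    (0 < k)%N -> #|T| = (2 ^ k)%N ->
    G \subset graph_aut e -> [transitive G, on [set: T] | 'P] ->
    split_metacyclic G ->
  metacirculant e.
Proof.
move=> k_gt0 cardT sGA trG /existsP[N /existsP[K]].
case/and3P=> /cyclicP[a Na] /cyclicP[b0 Kb] /eqP defG.
have [_ mulG nNK tiNK] := sdprodP defG.
(* Replacing [b0] by its 2-part gives a subgroup of odd index, which is still transitive. *)
set b := b0.`_2; have bb0 : b \in <[b0]> by rewrite mem_cycle.
have nab : b \in 'N(<[a]>) by rewrite -Na (subsetP nNK) // Kb.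
have ti : <[a]> :&: <[b]> = 1.
  by apply/trivgP; rewrite -tiNK Na Kb setIS // cycle_subG.
have sPG : <[a]> <*> <[b]> \subset G.
  by rewrite -mulG Na Kb joing_cycle_normal // mulgS // cycle_subG.
have tr : [transitive <[a]> <*> <[b]>, on [set: T] | 'P].
  apply: (@transitive_p'index _ G _ 2 k) => //.
  rewrite -p'natE //; suff -> : #|G : <[a]> <*> <[b]>| = (#[b0]`_2^')%N.
    exact: part_pnat.
  apply/eqP; rewrite -(eqn_pmul2l (cardG_gt0 (<[a]> <*> <[b]>))) Lagrange //.
  rewrite /= joing_cycle_normal // TI_cardMg // -(sdprod_card defG) Na Kb.
  by rewrite -mulnA -!orderE [#[b]]order_constt partnC.
have sr : semiregular_perms <[a]>.
  by apply: semiregular_normal_cycle trG _; rewrite -Na -mulG mulG_subG normG.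
have [Aa Ab] : a \in graph_aut e /\ b \in graph_aut e.
  by move: (subset_trans sPG sGA); rewrite join_subG !cycle_subG => /andP[].
have transitive_cycle s : s \in graph_aut e ->
    [transitive <[s]>, on [set: T] | 'P] -> metacirculant e.
  move=> As trs; have /imsetP[x _ _] := trs.
  apply: (@metacirculant_of_fixed _ _ s 1 x); rewrite ?group1 //.
  - by rewrite cycle1 joingG1.
  - exact: semiregular_normal_cycle trs (normG _).
  - apply: contraTneq (atrans_dvd trs) => ->.
    rewrite /= cycle1 cards1 cardsT cardT dvdn1 -(expn0 2) eqn_exp2l //.
    by rewrite -lt0n.
  by rewrite expg1n perm1.
have [a1 | a1] := eqVneq a 1.
  by apply: (transitive_cycle b); rewrite // -[<[b]>]joing1G -cycle1 -a1.
have pa : 2.-elt a.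
  have dv : #[a] %| 2 ^ k by rewrite -cardT (card_semiregular sr) dvdn_mull.
  by rewrite /p_elt (pnat_dvd dv) // pnatX.
have pb : 2.-elt b by apply: p_elt_constt.
have [v _ _] := imsetP tr.
have /p_natP[r Em] : 2.-nat #|porbits a|.
  have dv : #|porbits a| %| 2 ^ k.
    by rewrite -cardT (card_semiregular sr) dvdn_mulr.
  by rewrite (pnat_dvd dv) // pnatX.
case: r Em => [/eqP/cards1P[B EB] | r Em].
  apply: transitive_cycle Aa _; apply/imsetP; exists v; rewrite ?inE //.
  have porbB y : porbit a y = B by apply/set1P; rewrite -EB imset_f.
  by apply/setP=> y; rewrite inE -porbitE porbB -(porbB y) porbit_id.
have [u Eu] : exists u, a ^ (b ^+ (2 ^ r)) = a ^+ u.
  apply/cycleP; rewrite memJ_norm ?cycle_id //; exact: groupX.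
have u_odd : odd u.
  rewrite -[odd u]negbK -dvdn2; apply: contra a1 => dvd2u.
  have : coprime #[a] u.
    rewrite -generator_coprime /generator -Eu cycleJ.
    by apply/eqP/esym/normP; rewrite groupX.
  case/p_natP: pa => -[|w] oa; first by rewrite -order_eq1 oa.
  by rewrite oa coprime_pexpl // coprime2n -[odd u]negbK -dvdn2 dvd2u.
(* The number of orbits is now [2 ^ r.+1], so [c] is the square of [b ^+ (2 ^ r)] and acts on [a] by
   the exponent [u * u]. *)
set c := b ^+ #|porbits a|.
have cb : c \in <[b]> by rewrite mem_cycle.
have ac : a ^ c = a ^+ (u * u)%N.
  by rewrite /c Em expnSr expgM expgS expg1 conjgM Eu conjXg Eu expgM.
have /porbitP[i Ecv] := transitive_stab_porbit nab v tr.
set x := a ^- i; have xa : x \in <[a]> by rewrite groupV mem_cycle.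
have xc : x ^ c = x ^+ (u * u)%N.
  by rewrite conjVg conjXg ac expgVn -!expgM mulnC.
have cxv : (c * x) v = v by rewrite permM Ecv permK.
have /p_natP[t oc] : 2.-nat #[c] by apply: mem_p_elt cb.
(* This power lies in [<[a]>] because [c ^+ (2 ^ t) = 1], and it fixes [v]. *)
have cxt : (c * x) ^+ (2 ^ t) = 1.
  have /semiregularP sr1 := sr; apply: (sr1 _ v); last first.
    by rewrite permX iter_fix.
  by rewrite (expMg_twisted _ xc) -oc expg_order mul1g groupX.
have [] := @conj_of_faithful_action _ a c x (u * u) t pa _ ac xa _ cxt _.
- exact: odd_sqr_mod4.
- by rewrite -oc expg_order.
- move=> s Et; rewrite Et in oc cxt.
  exact: faithful_of_fixed nab ti tr cb oc xa xc cxv cxt.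
(* Since [c ^ y] fixes [v], [c] fixes [y^-1 v]. *)
move=> y Ey; apply: (@metacirculant_of_fixed _ _ a b (y^-1 v)) => //.
by apply: (@perm_inj _ y); rewrite permKV -[RHS]cxv Ey conjgE !permM.
Qed.

End Helpers.

Theorem theorem6p2 (T : finType) (e : rel T) (k : nat)
  (e_sym : symmetric e) (e_irr : irreflexive e)
  (e_conn : connected_graph e)
  (k_ge1 : (1 <= k)%N) (cardT : #|T| = (2 ^ k)%N)
  (e_weak : weak_metacirculant e) :
  metacirculant e <-> split_weak_metacirculant e.
Proof.
split=> [mc | [_ [G [sGA trG splitG]]]].
  by split=> //; apply: metacirculant_split.
exact: split_metacirculant k_ge1 cardT sGA trG splitG.
Qed.
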